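(* Let $2\le n\le l\le\infty$ and $r\ge0$. Equip $\mathrm{Ch}_n$ and $\mathrm{Ch}_l$ with their $r$-model structures. Then the adjunction $p_{l,n}\dashv i_{l,n}$, where $i_{l,n}\colon\mathrm{Ch}_n\to\mathrm{Ch}_l$ is the inclusion (restriction of scalars along $\Phi_{l,n}\colon\mathcal C_l\to\mathcal C_n$) and $p_{l,n}\colon\mathrm{Ch}_l\to\mathrm{Ch}_n$ is its left adjoint (extension of scalars $M\mapsto\mathcal C_n\otimes_{\mathcal C_l}M$), is a Quillen equivalence.
   Context: $R$ is a commutative unital ring. For $1\le n\le\infty$, an $n$-multicomplex is a $\mathbb Z\times\mathbb Z$-bigraded $R$-module $A$ with $R$-linear maps $d_i$ ($i\ge0$) of bidegree $(-i,1-i)$ such that $\sum_{i+j=l}(-1)^id_id_j=0$ for all $l\ge0$ and $d_i=0$ for $i\ge n$; morphisms are bidegree $(0,0)$ maps commuting with all $d_i$; category $\mathrm{Ch}_n$. For $n\le l$, an $n$-multicomplex is an $l$-multicomplex with $d_n=\dots=d_{l-1}=0$; this gives the inclusion $i_{l,n}$. Its left adjoint $p_{l,n}$ sends an $l$-multicomplex $M$ to the quotient of $M$ by the smallest sub-$l$-multicomplex containing $d_k(M)$ for all $k\ge n$. Equivalently, $\mathrm{Ch}_n$ is the category of modules in vertical bicomplexes over the dg algebra $\mathcal C_n=\mathcal C_\infty/I_n$, where $\mathcal C_\infty=R\langle d_1,d_2,\dots\rangle$ is free on $d_i$ of bidegree $(-i,1-i)$ with derivation $\delta_0(d_i)=\sum_{a+b=i,\,a,b\ge1}(-1)^{a+1}d_ad_b$,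 $I_n$ is the ideal generated by $d_k$ and $\delta_0(d_k)$ for $k\ge n$ ($I_\infty=0$), and $\Phi_{l,n}$ is the quotient map. Spectral sequence: $Z_0^{p,q}(A)=A^{p,q}$; for $r\ge1$, $Z_r^{p,q}(A)$ is the set of $a_0\in A^{p,q}$ for which there exist $a_j\in A^{p-j,q-j}$ ($1\le j\le r-1$) with $\sum_{i+j=l}(-1)^id_ia_j=0$ for $0\le l\le r-1$. $B_0=0$, $B_1^{p,q}(A)=A^{p,q}\cap\operatorname{im}d_0$, and for $r\ge2$, $B_r^{p,q}(A)$ is the set of $x\in A^{p,q}$ for which there exist $b_i\in A^{p+r-1-i,q+r-2-i}$ ($0\le i\le r-1$) with $x=\sum_{i=0}^{r-1}(-1)^id_ib_{r-1-i}$ and $\sum_{i=0}^l(-1)^id_ib_{l-i}=0$ for $0\le l\le r-2$. $E_r^{p,q}(A)=Z_r^{p,q}(A)/B_r^{p,q}(A)$, the spectral sequence of the column-filtered total complex. A morphism $f$ is an $E_r$-quasi-isomorphism if $E_{r+1}(f)$ is an isomorphism. The $r$-model structure on $\mathrm{Ch}_n$ ($2\le n\le\infty$, $r\ge0$) is the model structure whose weak equivalences are the $E_r$-quasi-isomorphisms and whose fibrations are the morphisms $f$ with $E_i(f)$ bidegree-wise surjective for all $0\le i\le r$ (cofibrations: left lifting property against trivial fibrations); it exists and is cofibrantly generated. *)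

(* Defs.v *)
From HB Require Import structures.
From mathcomp Require Import all_boot all_order all_algebra.
Set Implicit Arguments. Unset Strict Implicit. Unset Printing Implicit Defensive.
Import Order.TTheory GRing.Theory Num.Theory.
Local Open Scope ring_scope.

Inductive ninf := Fin of nat | Inf.

Definition ninf_le (a b : ninf) : Prop :=
  match a, b with
  | _, Inf => True
  | Inf, Fin _ => False
  | Fin x, Fin y => (x <= y)%N
  end.

Definition below (n : ninf) (i : nat) : Prop :=
  match n with Fin m => (i < m)%N | Inf => True end.

Section Mcx.
Variable R : comPzRingType.

(* A bigraded module A = (A^{p,q}) with maps d_i of bidegree (-i,1-i).
   A map of bidegree (-i,1-i) is encoded as a family of linear maps
   d_i^{p,q -> p',q'} : A^{p,q} -> A^{p',q'} which vanishes unless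
   (p',q') = (p-i, q+1-i); this avoids transport along index equalities. *)
Unset Implicit Arguments.
Record mcx := Mcx {
  mod_of : int -> int -> lmodType R;
  dd : nat -> forall p q p' q', mod_of p q -> mod_of p' q';
  dd_lin : forall i p q p' q', linear (dd i p q p' q');
  dd_deg : forall (i : nat) p q p' q', (p', q') <> (p - i%:Z, q + 1 - i%:Z) ->
     forall x, dd i p q p' q' x = 0;
  dd_rel : forall (l : nat) p q (x : mod_of p q),
     \sum_(j < l.+1) (-1) ^+ (l - j)%N *:
        dd (l - j)%N (p - (j : nat)%:Z) (q + 1 - (j : nat)%:Z) (p - l%:Z) (q + 2 - l%:Z)
           (dd j p q (p - (j : nat)%:Z) (q + 1 - (j : nat)%:Z) x) = 0 }.

Set Implicit Arguments.

Definition is_n (n : ninf) (A : mcx) : Prop :=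
  forall i, ~ below n i -> forall p q p' q' x, dd A i p q p' q' x = 0.

Unset Implicit Arguments.
Record mor (A B : mcx) := Mor {
  mfun : forall p q, mod_of A p q -> mod_of B p q;
  mfun_lin : forall p q, linear (mfun p q);
  mfun_comm : forall i p q p' q' x,
     mfun p' q' (dd A i p q p' q' x) = dd B i p q p' q' (mfun p q x) }.

Set Implicit Arguments.
Arguments mfun {A B} m p q.
Arguments dd m i p q p' q'.

Definition meq (A B : mcx) (f g : mor A B) : Prop :=
  forall p q x, mfun f p q x = mfun g p q x.

Lemma linear_comp (U V W : lmodType R) (f : U -> V) (g : V -> W) :
  linear f -> linear g -> linear (fun x => g (f x)).
Proof. by move=> Hf Hg a u v /=; rewrite Hf Hg. Qed.

Definition comp (A B C : mcx) (g : mor B C) (f : mor A B) : mor A C.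
Proof.
refine (@Mor A C (fun p q x => mfun g p q (mfun f p q x)) _ _).
- by move=> p q; apply: linear_comp; apply: mfun_lin.
- by move=> i p q p' q' x; rewrite mfun_comm mfun_comm.
Defined.

Lemma linear_f0 (U V : lmodType R) (f : U -> V) : linear f -> f 0 = 0.
Proof.
move=> Hf; have := Hf 1 0 0; rewrite scaler0 addr0 scale1r => H.
by apply: (@addrI _ (f 0)); rewrite addr0 -H.
Qed.

Definition zero_mcx : mcx.
Proof.
refine (@Mcx (fun _ _ => 'M[R]_(0,0)) (fun _ _ _ _ _ _ => 0) _ _ _).
- by move=> *; rewrite /linear_for /= => a u v; rewrite !flatmx0.
- by [].
- by move=> *; rewrite !flatmx0.
Defined.

Definition to_zero (A : mcx) : mor A zero_mcx.
Proof.
refine (@Mor A zero_mcx (fun _ _ _ => 0) _ _).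
- by move=> p q a u v; rewrite !flatmx0.
- by move=> *; rewrite !flatmx0.
Defined.

Definition from_zero (A : mcx) : mor zero_mcx A.
Proof.
refine (@Mor zero_mcx A (fun _ _ _ => 0) _ _).
- by move=> p q a u v /=; rewrite scaler0 addr0.
- by move=> i p q p' q' x /=; rewrite linear_f0 //; apply: dd_lin.
Defined.

Definition Zr (A : mcx) (r : nat) (p q : int) (x : mod_of A p q) : Prop :=
  exists a : forall j : nat, mod_of A (p - j%:Z) (q - j%:Z),
    forall l : nat, (l < r)%N ->
      (-1) ^+ l *: dd A l p q (p - l%:Z) (q + 1 - l%:Z) x
      + \sum_(1 <= j < l.+1) (-1) ^+ (l - j)%N *:
           dd A (l - j)%N _ _ (p - l%:Z) (q + 1 - l%:Z) (a j) = 0.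

(* B_r^{p,q}(A): x = sum_{i=0}^{r-1} (-1)^i d_i b_{r-1-i} with
   b_k in A^{p+r-1-k, q+r-2-k} and sum_{i=0}^{l} (-1)^i d_i b_{l-i} = 0
   for 0 <= l <= r-2.  (For r = 0 this gives B_0 = 0; for r = 1 it gives
   B_1 = A^{p,q} cap im d_0.) *)
Definition Br (A : mcx) (r : nat) (p q : int) (x : mod_of A p q) : Prop :=
  exists b : forall k : nat, mod_of A (p + r%:Z - 1 - k%:Z) (q + r%:Z - 2 - k%:Z),
    x = \sum_(i < r) (-1) ^+ (i : nat) *: dd A i _ _ p q (b (r.-1 - i)%N)
    /\ forall l : nat, (l.+1 < r)%N ->
        \sum_(i < l.+1) (-1) ^+ (i : nat) *:
           dd A i _ _ (p + r%:Z - 1 - l%:Z) (q + r%:Z - 1 - l%:Z) (b (l - i)%N) = 0.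

(* E_r(f) : Z_r/B_r -> Z_r/B_r, injective / surjective in every bidegree *)
Definition Er_inj (A B : mcx) (f : mor A B) (r : nat) : Prop :=
  forall p q (x : mod_of A p q), Zr r x -> Br r (mfun f p q x) -> Br r x.

Definition Er_surj (A B : mcx) (f : mor A B) (r : nat) : Prop :=
  forall p q (y : mod_of B p q), Zr r y ->
    exists2 x : mod_of A p q, Zr r x & Br r (mfun f p q x - y).

Definition Er_iso (A B : mcx) (f : mor A B) (r : nat) : Prop :=
  Er_inj f r /\ Er_surj f r.

Definition weq (r : nat) (A B : mcx) (f : mor A B) : Prop := Er_iso f r.+1.
Definition fib (r : nat) (A B : mcx) (f : mor A B) : Prop :=
  forall i, (i <= r)%N -> Er_surj f i.
Definition tfib (r : nat) (A B : mcx) (f : mor A B) : Prop := weq r f /\ fib r f.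

Definition cofib (n : ninf) (r : nat) (A B : mcx) (f : mor A B) : Prop :=
  forall (X Y : mcx), is_n n X -> is_n n Y ->
  forall (g : mor X Y), tfib r g ->
  forall (u : mor A X) (v : mor B Y), meq (comp g u) (comp v f) ->
  exists h : mor B X, meq (comp h f) u /\ meq (comp g h) v.

Definition cofibrant (n : ninf) (r : nat) (A : mcx) : Prop :=
  is_n n A /\ cofib n r (from_zero A).
Definition fibrant (n : ninf) (r : nat) (A : mcx) : Prop :=
  is_n n A /\ fib r (to_zero A).

(* (P, pi) is p_{l,n}(A) with its unit pi : A -> i_{l,n} p_{l,n} A, given by
   the universal property of the left adjoint of the inclusion. *)
Definition left_adj_unit (n : ninf) (A P : mcx) (pi : mor A P) : Prop :=
  is_n n P /\
  forall X, is_n n X -> forall g : mor A X,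
    exists f : mor P X, meq (comp f pi) g /\
      forall f' : mor P X, meq (comp f' pi) g -> meq f' f.

(* p_{l,n} -| i_{l,n} is a Quillen equivalence for the r-model structures:
   (1) the right adjoint i_{l,n} preserves fibrations and trivial fibrations;
   (2) for cofibrant A in Ch_l and fibrant X in Ch_n, a map f : p A -> X is a
       weak equivalence iff its adjunct f o pi : A -> i X is. *)
Definition quillen_equiv_incl (n l : ninf) (r : nat) : Prop :=
  (forall (X Y : mcx) (f : mor X Y), is_n n X -> is_n n Y ->
      (fib r f -> is_n l X /\ is_n l Y /\ fib r f) /\
      (tfib r f -> is_n l X /\ is_n l Y /\ tfib r f))
  /\
  (forall (A : mcx), is_n l A -> cofibrant l r A ->
   forall (P : mcx) (pi : mor A P), left_adj_unit n pi ->
   forall (X : mcx), fibrant n r X ->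
   forall f : mor P X, weq r f <-> weq r (comp f pi)).

End Mcx.
Arguments dd {R} m i p q p' q'.
Arguments mfun {R A B} m p q.

(* Main.v *)
Require Import Defs.
From HB Require Import structures.
From mathcomp Require Import all_boot all_order all_algebra zify.
From mathcomp Require Import boolp.
Set Implicit Arguments. Unset Strict Implicit. Unset Printing Implicit Defensive.
Import Order.TTheory GRing.Theory Num.Theory.
Local Open Scope ring_scope.

(** With e_i := (-1)^p d_i on column p the multicomplex relations become
    sum_(i+j=l) e_i e_j = 0. Let F_(p,q) be the product of the A^{p-j,q-j}, j >= 0,
    with total differential D. The cone of F_(p-1) -> F_p gives a bicomplex Y(A):
      Y(A)^{p,q} = F_(p,q) x F_(p-1,q),
      e_0 (x, y) = (D x + y, - D y),  e_1 (x, y) = (- y, 0),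
    and phi_i a = ([i = 0] a, - (e_(i+1) a, e_(i+2) a, ...)) is an oo-morphism A ~> Y(A)
    which is a quasi-isomorphism for e_0 and has phi_i = 0 for i >= n if A lies in Ch_n.
    Its cocylinder X(A) = A x Y(A) x Y(A)[-1] is an l-multicomplex whenever A is, and the
    two projections X(A) -> A and X(A) -> Y(A) are strict surjections with e_0-acyclic
    kernel, hence trivial fibrations for every r.

    If A is cofibrant then X(A) -> A has a section s. For the unit pi : A -> P, the map
    A -> X(A) -> Y(A) factors as f pi with f : P -> Y(A), since Y(A) is a bicomplex, and
    X(pi) s factors as t pi with t : P -> X(P), since X(P) lies in Ch_n. By uniqueness t is
    a section of X(P) -> P and Y(pi) f is P -> X(P) -> Y(P). So f pi and Y(pi) f are weak
    equivalences, which forces f and then pi to be weak equivalences. The Quillen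
    equivalence follows by two-out-of-three. *)

(** * Signs depending on the column *)

Definition column_sign (R : comPzRingType) (p : int) : R := (-1) ^+ odd `|p|%N.

Lemma column_signB (R : comPzRingType) (p : int) (j : nat) :
  column_sign R (p - j%:Z) = (-1) ^+ j * column_sign R p.
Proof.
rewrite /column_sign -[in RHS](signr_odd R j) -signr_addb; congr (_ ^+ nat_of_bool _).
lia.
Qed.

Lemma column_sign_sqr (R : comPzRingType) (p : int) :
  column_sign R p * column_sign R p = 1.
Proof. by rewrite /column_sign -signr_addb addbb. Qed.

(** * Products of sequences of modules *)

Section Seq.
Variables (R : comPzRingType) (M : nat -> lmodType R).
Definition fam := forall j, M j.
HB.instance Definition _ := gen_eqMixin fam.
HB.instance Definition _ := gen_choiceMixin fam.
Let addf (x y : fam) : fam := fun j => x j + y j.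
Let oppf (x : fam) : fam := fun j => - x j.
Let zerof : fam := fun j => 0.
Let scalef (a : R) (x : fam) : fam := fun j => a *: x j.
Fact fam_addA : associative addf.
Proof. by move=> x y z; apply: functional_extensionality_dep => j; apply: addrA. Qed.
Fact fam_addC : commutative addf.
Proof. by move=> x y; apply: functional_extensionality_dep => j; apply: addrC. Qed.
Fact fam_add0 : left_id zerof addf.
Proof. by move=> x; apply: functional_extensionality_dep => j; apply: add0r. Qed.
Fact fam_addN : left_inverse zerof oppf addf.
Proof. by move=> x; apply: functional_extensionality_dep => j; apply: addNr. Qed.
HB.instance Definition _ := GRing.isZmodule.Build fam fam_addA fam_addC fam_add0 fam_addN.
Fact fam_scA a b x : scalef a (scalef b x) = scalef (a * b) x.
Proof. by apply: functional_extensionality_dep => j; apply: scalerA. Qed.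
Fact fam_sc1 : left_id 1 scalef.
Proof. by move=> x; apply: functional_extensionality_dep => j; apply: scale1r. Qed.
Fact fam_scDr : right_distributive scalef +%R.
Proof. by move=> a x y; apply: functional_extensionality_dep => j; apply: scalerDr. Qed.
Fact fam_scDl x : {morph scalef^~ x : a b / a + b}.
Proof. by move=> a b; apply: functional_extensionality_dep => j; apply: scalerDl. Qed.
HB.instance Definition _ :=
  GRing.Zmodule_isLmodule.Build R fam fam_scA fam_sc1 fam_scDr fam_scDl.

Lemma famDE (x y : fam) j : (x + y) j = x j + y j. Proof. by []. Qed.
Lemma famNE (x : fam) j : (- x) j = - x j. Proof. by []. Qed.
Lemma fam0E j : (0 : fam) j = 0. Proof. by []. Qed.
Lemma famZE a (x : fam) j : (a *: x) j = a *: x j. Proof. by []. Qed.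
Lemma fam_sumE I (r : seq I) (P : pred I) (G : I -> fam) j :
  (\sum_(i <- r | P i) G i) j = \sum_(i <- r | P i) G i j.
Proof. by elim/big_rec2: _ => // i y x _ <-. Qed.
End Seq.

(** * Identity maps between bidegrees *)

Section Idm.
Variables (R : comPzRingType) (M : int -> int -> lmodType R).

(* The identity if (p, q) = (p', q') and 0 otherwise, in the style of [dd]: this
   replaces transport along equalities of bidegrees. *)
Definition idm p q p' q' (x : M p q) : M p' q' :=
  if pselect ((p, q) = (p', q')) is left e
  then ecast z (M z.1 z.2) e x else 0.

Lemma idm_id p q (x : M p q) : idm p q x = x.
Proof. by rewrite /idm; case: pselect => // e; rewrite (Prop_irrelevance e erefl). Qed.

Lemma idm_neq p q p' q' (x : M p q) : (p', q') <> (p, q) -> idm p' q' x = 0.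
Proof. by rewrite /idm; case: pselect => // e /(_ (esym e)). Qed.

Lemma idm_lin p q p' q' : linear (@idm p q p' q').
Proof.
move=> a u v; rewrite /idm; case: pselect => [e|]; last by rewrite scaler0 addr0.
by case: (e) => e1 e2; subst p' q'; rewrite (Prop_irrelevance e erefl).
Qed.
HB.instance Definition _ p q p' q' :=
  GRing.isLinear.Build R _ _ _ (@idm p q p' q') (@idm_lin p q p' q').
End Idm.

HB.instance Definition _ (R : comPzRingType) (A B : mcx R) (f : mor R A B) p q :=
  GRing.isLinear.Build R _ _ _ (mfun f p q) (mfun_lin _ _ _ f p q).

HB.instance Definition _ (R : comPzRingType) (A : mcx R) i p q p' q' :=
  GRing.isLinear.Build R _ _ _ (dd A i p q p' q') (dd_lin _ A i p q p' q').

(** * Multicomplex relations without signs *)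

Section NormalisedDifferentials.
Variables (R : comPzRingType) (A : mcx R).

Definition ndd i p q p' q' (x : mod_of _ A p q) : mod_of _ A p' q' :=
  column_sign R p *: dd A i p q p' q' x.

Lemma ndd_lin i p q p' q' : linear (@ndd i p q p' q').
Proof. by move=> a u v; rewrite /ndd dd_lin scalerDr !scalerA mulrC. Qed.
HB.instance Definition _ i p q p' q' :=
  GRing.isLinear.Build R _ _ _ (@ndd i p q p' q') (@ndd_lin i p q p' q').

Lemma ndd_deg i p q p' q' x : (p', q') <> (p - i%:Z, q + 1 - i%:Z) -> @ndd i p q p' q' x = 0.
Proof. by move=> H; rewrite /ndd dd_deg // scaler0. Qed.

Lemma ddE i p q p' q' x : dd A i p q p' q' x = column_sign R p *: ndd i p' q' x.
Proof. by rewrite /ndd scalerA column_sign_sqr scale1r. Qed.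

(** The column signs (-1)^p and (-1)^(p-j) multiply to (-1)^j, which is (-1)^l times the sign
    (-1)^(l-j) in [dd_rel]. For any target other than (p - l, q + 2 - l) each term vanishes by
    degree, so (u, v) can stay arbitrary and no bidegrees need matching in later uses. *)
Lemma ndd_rel l p q u v (x : mod_of _ A p q) :
  \sum_(j < l.+1) ndd (l - j) u v (ndd j (p - j%:Z) (q + 1 - j%:Z) x) = 0.
Proof.
have [[-> ->]|ne] := pselect ((u, v) = (p - l%:Z, q + 2 - l%:Z)); last first.
  rewrite big1 // => j _; apply: ndd_deg => -[h1 h2]; apply: ne.
  have jl := ltn_ord j; congr (_, _); lia.
transitivity ((-1) ^+ l *: (0 : mod_of _ A (p - l%:Z) (q + 2 - l%:Z))); last by rewrite scaler0.
rewrite -[X in _ = _ *: X](@dd_rel _ A l p q x) scaler_sumr; apply: eq_bigr => j _.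
rewrite /ndd linearZ /= !scalerA; congr (_ *: _).
rewrite column_signB -mulrA column_sign_sqr mulr1 -exprD.
rewrite -(signr_odd R j) -[RHS]signr_odd; congr (_ ^+ nat_of_bool _).
have jl := ltn_ord j; lia.
Qed.

Lemma ndd_idm i p q p' q' u v (x : mod_of _ A p q) : p = p' -> q = q' ->
  ndd i u v (idm p' q' x) = ndd i u v x.
Proof. by move=> <- <-; rewrite idm_id. Qed.

Lemma idm_ndd i p q p' q' u v (x : mod_of _ A p q) :
  p' = p - i%:Z -> q' = q + 1 - i%:Z ->
  idm u v (ndd i p' q' x) = ndd i u v x.
Proof.
move=> hp hq; have [[e1 e2]|ne] := pselect ((u, v) = (p', q')).
  by subst u v; rewrite idm_id.
by rewrite idm_neq // ndd_deg // => -[h1 h2]; apply: ne; rewrite h1 h2 hp hq.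
Qed.
End NormalisedDifferentials.

Lemma mfun_ndd (R : comPzRingType) (A B : mcx R) (f : mor R A B) i p q p' q' (x : mod_of R A p q) :
  mfun f p' q' (ndd i p' q' x) = ndd i p' q' (mfun f p q x).
Proof. by rewrite /ndd linearZ /= mfun_comm. Qed.

Lemma mfun_idm (R : comPzRingType) (A B : mcx R) (f : mor R A B) p q p' q' x :
  mfun f p' q' (idm p' q' x) = idm p' q' (mfun f p q x).
Proof.
have [[e1 e2]|ne] := pselect ((p', q') = (p, q)); last by rewrite !idm_neq // linear0.
by subst p' q'; rewrite !idm_id.
Qed.

Lemma linear_scale (R : comPzRingType) (U V : lmodType R) (f : U -> V) a x :
  linear f -> f (a *: x) = a *: f x.
Proof. by move=> fl; have := fl a x 0; rewrite (linear_f0 fl) !addr0. Qed.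

(** * Multicomplexes from differentials without signs *)

Section Build.
Variables (R : comPzRingType) (M : int -> int -> lmodType R)
  (e : nat -> forall p q p' q', M p q -> M p' q').
Arguments e : clear implicits.
Hypothesis e_lin : forall i p q p' q', linear (e i p q p' q').
Hypothesis e_deg : forall (i : nat) p q p' q',
  (p', q') <> (p - i%:Z, q + 1 - i%:Z) -> forall x, e i p q p' q' x = 0.
Hypothesis e_rel : forall (l : nat) p q u v x,
  \sum_(j < l.+1) e (l - j)%N (p - j%:Z) (q + 1 - j%:Z) u v
     (e j p q (p - j%:Z) (q + 1 - j%:Z) x) = 0.

Definition build : mcx R.
Proof.
refine (@Mcx R M (fun i p q p' q' x => column_sign R p *: e i p q p' q' x) _ _ _).
- by move=> i p q p' q' a u v; rewrite e_lin scalerDr !scalerA mulrC.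
- by move=> i p q p' q' ne x; rewrite e_deg ?scaler0.
- move=> l p q x.
  transitivity ((-1) ^+ l *: (0 : M (p - l%:Z) (q + 2 - l%:Z))); last by rewrite scaler0.
  rewrite -[X in _ = _ *: X](@e_rel l p q _ _ x) scaler_sumr; apply: eq_bigr => j _.
  rewrite (linear_scale _ _ (@e_lin _ _ _ _ _)).
  rewrite !scalerA; congr (_ *: _).
  rewrite column_signB -!mulrA column_sign_sqr mulr1 -exprD.
  rewrite subnK //; have := ltn_ord j; lia.
Defined.

Lemma ndd_build i p q p' q' x : @ndd R build i p q p' q' x = e i p q p' q' x.
Proof. by rewrite /ndd /= scalerA column_sign_sqr scale1r. Qed.
End Build.

(** * The total differential, and Z_r and B_r in terms of it *)

Lemma sum_triangle (V : nmodType) (G : nat -> nat -> V) l :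
  \sum_(m < l.+1) \sum_(j < m.+1) G m j =
  \sum_(j < l.+1) \sum_(i < (l - j).+1) G (j + i)%N j.
Proof.
elim: l => [|l IH]; first by rewrite !big_ord1.
rewrite big_ord_recr /= IH [RHS]big_ord_recr /= subnn big_ord1 addn0.
rewrite [X in _ + X]big_ord_recr /= addrA; congr (_ + _).
rewrite -big_split /=; apply: eq_bigr => j _.
have jl : (j <= l)%N by rewrite -ltnS.
by rewrite (subSn jl) [RHS]big_ord_recr /= addnS subnKC.
Qed.

Lemma idmK (R : comPzRingType) (M : int -> int -> lmodType R) p q p' q' (x : M p q) :
  p' = p -> q' = q -> idm p q (idm p' q' x) = x.
Proof. by move=> -> ->; rewrite !idm_id. Qed.

Section Total.
Variables (R : comPzRingType) (A : mcx R).

Definition colseq p q := fam (fun j => mod_of R A (p - j%:Z) (q - j%:Z)).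

(** Component l of the total differential D. It involves only the entries 0 to l, so the truncated
    conditions defining Z_r and B_r can be expressed by it. *)
Definition totat l u v p q (x : colseq p q) : mod_of R A u v :=
  \sum_(j < l.+1) ndd (l - j) u v (x j).

Lemma totat_lin l u v p q : linear (@totat l u v p q).
Proof.
move=> a x y; rewrite /totat scaler_sumr -big_split; apply: eq_bigr => j _.
by rewrite linearP.
Qed.
HB.instance Definition _ l u v p q :=
  GRing.isLinear.Build R _ _ _ (@totat l u v p q) (@totat_lin l u v p q).

Lemma totat_deg l u v p q (x : colseq p q) :
  (u, v) <> (p - l%:Z, q + 1 - l%:Z) -> totat l u v x = 0.
Proof.
move=> ne; rewrite /totat big1 // => j _; apply: ndd_deg => -[h1 h2]; apply: ne.
have := ltn_ord j => jl; congr (_, _); lia.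
Qed.

Lemma idm_totat l u v u' v' p q (x : colseq p q) : u' = u -> v' = v ->
  idm u' v' (totat l u v x) = totat l u' v' x.
Proof. by move=> -> ->; rewrite idm_id. Qed.

Definition tot p' q' p q (x : colseq p q) : colseq p' q' :=
  fun l => totat l (p' - l%:Z) (q' - l%:Z) x.

Lemma tot_lin p' q' p q : linear (@tot p' q' p q).
Proof. by move=> a x y; apply: functional_extensionality_dep => j; apply: totat_lin. Qed.
HB.instance Definition _ p' q' p q :=
  GRing.isLinear.Build R _ _ _ (@tot p' q' p q) (@tot_lin p' q' p q).

Lemma tot_deg p' q' p q (x : colseq p q) :
  (p', q') <> (p, q + 1) -> tot p' q' x = 0.
Proof.
move=> ne; apply: functional_extensionality_dep => j; apply: totat_deg => -[h1 h2].
by apply: ne; congr (_, _); lia.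
Qed.

(** After reordering the double sum, the terms coming from a fixed entry x_j form the relation of
    index l - j. *)
Lemma totat_tot l u v p1 q1 p q (x : colseq p q) : totat l u v (tot p1 q1 x) = 0.
Proof.
have [[-> ->]|ne] := pselect ((p1, q1) = (p, q + 1)); last by rewrite tot_deg ?linear0.
rewrite /totat /tot /totat.
under eq_bigr do rewrite linear_sum.
rewrite (sum_triangle (fun m j => ndd (l - m) u v
  (ndd (m - j) (p - m%:Z) (q + 1 - m%:Z) (x j)))) big1 // => j _.
rewrite -[RHS](@ndd_rel R A (l - j) _ _ u v (x j)); apply: eq_bigr => i _.
rewrite subnDA addKn.
have -> : p - (j + i)%:Z = p - j%:Z - i%:Z by lia.
by have -> : q + 1 - (j + i)%:Z = q - j%:Z + 1 - i%:Z by lia.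
Qed.

Lemma tot_tot p2 q2 p1 q1 p q (x : colseq p q) : tot p2 q2 (tot p1 q1 x) = 0.
Proof. by apply: functional_extensionality_dep => l; apply: totat_tot. Qed.

Definition upd p q (x : colseq p q) k (u : mod_of R A (p - k%:Z) (q - k%:Z)) : colseq p q :=
  fun j => if j == k then idm _ _ u else x j.

Arguments upd [p q] x k u.

Lemma upd_at p q (x : colseq p q) k u : upd x k u k = u.
Proof. by rewrite /upd eqxx idm_id. Qed.

Lemma upd_other p q (x : colseq p q) k (u : mod_of R A (p - k%:Z) (q - k%:Z)) j :
  j != k -> upd x k u j = x j.
Proof. by rewrite /upd => /negPf ->. Qed.

Lemma eq_totat l u v p q (x y : colseq p q) : (forall j, (j <= l)%N -> x j = y j) ->
  totat l u v x = totat l u v y.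
Proof. by move=> h; apply: eq_bigr => j _; rewrite h // -ltnS. Qed.

Lemma totat_upd u v p q (x : colseq p q) k w :
  totat k u v (upd x k w) = \sum_(j < k) ndd (k - j) u v (x j) + ndd 0 u v w.
Proof.
rewrite /totat big_ord_recr /= subnn upd_at; congr (_ + _); apply: eq_bigr => j _.
by rewrite upd_other // neq_ltn ltn_ord.
Qed.

(** The equation of index l in [Zr] is (-1)^l (-1)^p times (D a)_l = 0, where x is placed in entry 0
    of a. [idm] bridges the bidegrees (p - 0, q - 0) and (p, q). *)
Lemma Zr_tot r p q (x : mod_of R A p q) :
  Zr r x <-> exists2 a : colseq p q, a 0%N = idm _ _ x &
    forall l, (l < r)%N -> totat l (p - l%:Z) (q + 1 - l%:Z) a = 0.
Proof.
have key (a : colseq p q) l : a 0%N = idm _ _ x ->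
  (-1) ^+ l *: dd A l p q (p - l%:Z) (q + 1 - l%:Z) x
      + \sum_(1 <= j < l.+1) (-1) ^+ (l - j)%N *:
           dd A (l - j)%N _ _ (p - l%:Z) (q + 1 - l%:Z) (a j) =
  ((-1) ^+ l * column_sign R p) *: totat l (p - l%:Z) (q + 1 - l%:Z) a.
  move=> a0; rewrite /totat big_ord_recl /= a0 subn0 ndd_idm ?subr0 // scalerDr ddE scalerA.
  congr (_ + _); rewrite big_add1 /= big_mkord scaler_sumr; apply: eq_bigr => j _.
  rewrite ddE column_signB !scalerA /bump /= add1n mulrA -exprD subnK //.
split=> [[a ha]|[a a0 ha]].
(* [Zr] uses its sequence only from entry 1 on, so entry 0 is free to be set to x. *)
- exists (upd a 0 (idm (p - 0%:Z) (q - 0%:Z) x)) => [|l lr]; first by rewrite upd_at.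
  have := key (upd a 0 (idm (p - 0%:Z) (q - 0%:Z) x)) l (upd_at _ _).
  have -> : \sum_(1 <= j < l.+1) (-1) ^+ (l - j)%N *:
           dd A (l - j)%N _ _ (p - l%:Z) (q + 1 - l%:Z) (upd a 0 (idm (p - 0%:Z) (q - 0%:Z) x) j)
     = \sum_(1 <= j < l.+1) (-1) ^+ (l - j)%N *:
           dd A (l - j)%N _ _ (p - l%:Z) (q + 1 - l%:Z) (a j).
    apply: eq_big_nat => j /andP[j0 _]; by rewrite upd_other // -lt0n.
  rewrite ha // => /(congr1 (fun y => ((-1) ^+ l * column_sign R p) *: y)).
  rewrite scaler0 scalerA mulrACA column_sign_sqr -exprD addnn -signr_odd odd_double.
  by rewrite mulr1 scale1r => <-.
- by exists a => l lr; rewrite key // ha // scaler0.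
Qed.

Lemma Br0 p q (x : mod_of R A p q) : Br 0 x <-> x = 0.
Proof.
split=> [[b [-> _]]|->]; first by rewrite big_ord0.
by exists (fun=> 0); split=> //; rewrite big_ord0.
Qed.

Lemma dd_totat p q (b : colseq p q) l u v : u = p - l%:Z ->
  \sum_(i < l.+1) (-1) ^+ (i : nat) *: dd A i _ _ u v (b (l - i)%N) =
  ((-1) ^+ l * column_sign R p) *: totat l u v b.
Proof.
move=> hu; rewrite /totat scaler_sumr (reindex_inj rev_ord_inj) /=.
apply: eq_bigr => j _; have jl : (j <= l)%N by rewrite -ltnS.
rewrite subSS subKn // ddE column_signB !scalerA mulrA -exprD subnK //.
Qed.

(** Each sum in [Br] is [c l] times a component of D b. The sign [c k] in the formula for x is
    absorbed by rescaling b, which keeps the other components zero. *)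
Lemma Br_tot k p q (x : mod_of R A p q) :
  Br k.+1 x <-> exists2 b : colseq (p + k.+1%:Z - 1) (q + k.+1%:Z - 2),
    x = totat k p q b &
    forall l, (l < k)%N ->
      totat l (p + k.+1%:Z - 1 - l%:Z) (q + k.+1%:Z - 1 - l%:Z) b = 0.
Proof.
have hp : p = p + k.+1%:Z - 1 - k%:Z by lia.
set P := p + k.+1%:Z - 1; rewrite -/P in hp; set c := fun l => (-1) ^+ l * column_sign R P.
have cc l : c l * c l = 1.
  rewrite /c mulrACA column_sign_sqr -exprD addnn -signr_odd odd_double.
  by rewrite mulr1.
split=> [[b [hx hb]]|[b hx hb]].
- exists (c k *: (b : colseq _ _)); first by rewrite linearZ /= -dd_totat.
  move=> l lk; rewrite linearZ /=; have := hb l lk; rewrite dd_totat //.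
  move=> /(congr1 (fun y => c l *: y)); rewrite scalerA cc scale1r scaler0 => ->.
  by rewrite scaler0.
- exists (c k *: (b : colseq _ _)); split.
    rewrite (dd_totat (c k *: b : colseq _ _)) // linearZ /= -/(c k) scalerA cc scale1r //.
  move=> l lk; rewrite (dd_totat (c k *: b : colseq _ _)) // linearZ /= hb //.
  by rewrite !scaler0.
Qed.

End Total.
Arguments upd [R A p q] x k u.

Lemma Br_zero (R : comPzRingType) (A : mcx R) r p q : Br r (0 : mod_of R A p q).
Proof.
case: r => [|r]; first exact/Br0.
by apply/Br_tot; exists 0; rewrite ?linear0 // => l _; rewrite linear0.
Qed.

(** * Surjections with e_0-acyclic kernel are trivial fibrations *)

Section AcyclicSurjection.
Variables (R : comPzRingType) (A B : mcx R) (f : mor R A B).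

Definition surjective_mor := forall p q y, exists x, mfun f p q x = y.

(** The separate variable q' with its equation lets this apply in degrees that are successors only
    up to a provable equality. *)
Definition acyclic_kernel := forall p q q' (x : mod_of R A p q'), q' = q + 1 ->
  mfun f p q' x = 0 -> (forall v, ndd 0 p v x = 0) ->
  exists2 w : mod_of R A p q, mfun f p q w = 0 & ndd 0 p q' w = x.

Lemma mfun_totat l u v p q (x : colseq A p q) :
  mfun f u v (totat l u v x) =
  totat l u v ((fun j => mfun f _ _ (x j)) : colseq B p q).
Proof. by rewrite /totat linear_sum; apply: eq_bigr => j _ /=; rewrite mfun_ndd. Qed.

Hypotheses (f_surj : surjective_mor) (f_acyc : acyclic_kernel).

(** Obstruction theory, one entry at a time: the obstruction to the next equation is an e_0-cycle in
    the kernel of f, and a primitive of it corrects the lift. Taking z = 0 lifts cycles; taking z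
    concentrated in its last entry reflects boundaries. *)
Lemma lift_colseq k p q q' (z : colseq A p q') (y : colseq B p q) : q' = q + 1 ->
  (forall l v, (l < k)%N -> totat l (p - l%:Z) v z = 0) ->
  (forall l, (l < k)%N ->
     totat l (p - l%:Z) (q' - l%:Z) y = mfun f _ _ (z l)) ->
  exists x : colseq A p q, forall l, (l < k)%N ->
    mfun f _ _ (x l) = y l /\ totat l (p - l%:Z) (q' - l%:Z) x = z l.
Proof.
move=> hq; elim: k => [|k IH] hz hy; first by exists 0.
have {IH}[||x hx] := IH.
- by move=> l v lk; apply: hz; apply: ltnW.
- by move=> l lk; apply: hy; apply: ltnW.
have [u hu] := f_surj (y k).
pose x1 := upd x k u.
have x1E j : (j < k)%N -> x1 j = x j by move=> jk; rewrite /x1 upd_other // neq_ltn jk.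
have x1y j : (j <= k)%N -> mfun f _ _ (x1 j) = y j.
  rewrite leq_eqVlt => /orP[/eqP ->|jk]; first by rewrite /x1 upd_at.
  by rewrite x1E //; case: (hx j jk).
have x1z l : (l < k)%N -> totat l (p - l%:Z) (q' - l%:Z) x1 = z l.
  move=> lk; have [_ <-] := hx l lk; apply: eq_totat => j jl.
  by rewrite x1E // (leq_ltn_trans jl).
(* The defect in equation k when y_k is lifted by an arbitrary u. *)
pose c := totat k (p - k%:Z) (q' - k%:Z) x1 - z k.
have [|||w fw cw] := @f_acyc (p - k%:Z) (q - k%:Z) (q' - k%:Z) c.
- lia.
- rewrite linearB /= -hy // mfun_totat; apply/eqP; rewrite subr_eq0; apply/eqP.
  by apply: eq_totat => j jk; apply: x1y.
(* e_0 c = 0: the equations (D z)_k = 0 and (D D x1)_k = 0 express both e_0-terms through earlier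
   entries, where D x1 and z agree. *)
- move=> v; rewrite linearB /=.
  have := hz k v (ltnSn k); rewrite {1}/totat big_ord_recr /= subnn => /eqP.
  rewrite addrC addr_eq0 => /eqP ->.
  have := totat_tot k (p - k%:Z) v p q' x1; rewrite {1}/totat big_ord_recr /= subnn => /eqP.
  rewrite addrC addr_eq0 => /eqP ->; apply/eqP; rewrite subr_eq0 eqr_opp.
  by apply/eqP; apply: eq_bigr => j _; rewrite /tot x1z.
exists (upd x k (u - w)) => l; rewrite ltnS leq_eqVlt => /orP[/eqP ->|lk].
  rewrite upd_at linearB /= fw subr0; split=> //.
  rewrite totat_upd linearB /= addrA -totat_upd cw /c -/x1.
  by rewrite opprB addrC subrK.
have neq j : (j <= l)%N -> upd x k (u - w) j = x j.
  by move=> jl; rewrite upd_other // neq_ltn (leq_ltn_trans jl).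
by rewrite neq // (eq_totat _ _ neq); apply: hx.
Qed.

Lemma acyclic_surj_Er_surj r : Er_surj f r.
Proof.
move=> p q y; rewrite Zr_tot => -[a a0 ha].
have [x0 hx0] := f_surj y.
have [|||x hx] := @lift_colseq r p q (q + 1) 0 a.
- by [].
- by move=> l v lr; rewrite linear0.
- by move=> l lr; rewrite ha // linear0.
(* For r = 0 the lift controls no entry, and surjectivity of f is used directly. *)
case: r hx {ha} => [|r] hx.
  by exists x0; [exists (fun=> 0)|rewrite hx0 subrr; apply: Br_zero].
exists (idm p q (x 0%N)).
  rewrite Zr_tot; exists x; first by rewrite idmK // subr0.
  by move=> l lr; case: (hx l lr).
have [h _] := hx 0%N isT.
by rewrite mfun_idm h a0 idmK ?subr0 // subrr; apply: Br_zero.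
Qed.

(** At a positive index, x in Z_(r+1) gives e_0 x = 0. Hence the sequence z with x in entry r and
    zeros elsewhere has D z = 0 up to entry r, and the sequence bounding f x lifts to one bounding
    x. *)
Lemma acyclic_surj_Er_inj r : Er_inj f r.+1.
Proof.
move=> p q x zx; rewrite !Br_tot => -[b fx hb].
set P := p + r.+1%:Z - 1; set Q := q + r.+1%:Z - 2; set Q' := q + r.+1%:Z - 1.
have hP : P - r%:Z = p by rewrite /P; lia.
have hQ : Q' - r%:Z = q by rewrite /Q'; lia.
have x0 u v : ndd 0 u v x = 0.
  have [[-> ->]|ne] := pselect ((u, v) = (p - 0%:Z, q + 1 - 0%:Z)); last by rewrite ndd_deg.
  move: zx; rewrite Zr_tot => -[a a0 /(_ 0%N isT)].
  by rewrite /totat big_ord1 a0 subnn ndd_idm // subr0.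
pose z : colseq A P Q' := upd 0 r (idm _ _ x).
have zl j : (j < r)%N -> z j = 0 by move=> jr; rewrite /z upd_other // neq_ltn jr.
have [|||y hy] := @lift_colseq r.+1 P Q Q' z b.
- by rewrite /Q' /Q; lia.
- move=> l v; rewrite ltnS leq_eqVlt => /orP[/eqP ->|lr].
    rewrite totat_upd big1 ?add0r ?ndd_idm // => j _; by rewrite linear0.
  by rewrite (@eq_totat _ _ _ _ _ _ _ _ 0) ?linear0 // => j jl; rewrite zl // (leq_ltn_trans jl).
- move=> l; rewrite ltnS leq_eqVlt => /orP[/eqP ->|lr].
    by rewrite /z upd_at mfun_idm fx idm_totat.
  by rewrite hb // zl // linear0.
exists y.
  have [_] := hy r (ltnSn r); rewrite /z upd_at => /(congr1 (@idm R (mod_of R A) _ _ p q)).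
  by rewrite idm_totat // idmK.
by move=> l lr; have [_ ->] := hy l (ltnW lr); rewrite zl.
Qed.

Lemma acyclic_surj_weq r : weq r f.
Proof. by split; [apply: acyclic_surj_Er_inj|apply: acyclic_surj_Er_surj]. Qed.

Lemma acyclic_surj_tfib r : tfib r f.
Proof. by split=> [|i _]; [apply: acyclic_surj_weq|apply: acyclic_surj_Er_surj]. Qed.

End AcyclicSurjection.

(** * Two-out-of-three for isomorphisms on E_r *)

Section TwoOfThree.
Variable R : comPzRingType.

Lemma ZrB (A : mcx R) r p q (x y : mod_of R A p q) : Zr r x -> Zr r y -> Zr r (x - y).
Proof.
rewrite !Zr_tot => -[a a0 ha] [b b0 hb]; exists (a - b).
  by rewrite famDE famNE a0 b0 linearB.
by move=> l lr; rewrite linearB /= ha // hb // subr0.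
Qed.

Lemma BrB (A : mcx R) r p q (x y : mod_of R A p q) : Br r x -> Br r y -> Br r (x - y).
Proof.
case: r => [|r]; first by rewrite !Br0 => -> ->; rewrite subr0.
rewrite !Br_tot => -[a a0 ha] [b b0 hb]; exists (a - b).
  by rewrite linearB a0 b0.
by move=> l lr; rewrite linearB /= ha // hb // subr0.
Qed.

Lemma Zr_mfun (A B : mcx R) (f : mor R A B) r p q (x : mod_of R A p q) :
  Zr r x -> Zr r (mfun f p q x).
Proof.
rewrite !Zr_tot => -[a a0 ha]; exists (fun j => mfun f _ _ (a j)).
  by rewrite a0 mfun_idm.
by move=> l lr; rewrite -mfun_totat ha // linear0.
Qed.

Lemma Br_mfun (A B : mcx R) (f : mor R A B) r p q (x : mod_of R A p q) :
  Br r x -> Br r (mfun f p q x).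
Proof.
case: r => [|r]; first by rewrite !Br0 => ->; rewrite linear0.
rewrite !Br_tot => -[a a0 ha]; exists (fun j => mfun f _ _ (a j)).
  by rewrite a0 mfun_totat.
by move=> l lr; rewrite -mfun_totat ha // linear0.
Qed.

Variables (A B C : mcx R) (f : mor R A B) (g : mor R B C) (r : nat).

Lemma Er_inj_compl : Er_inj (Defs.comp g f) r -> Er_inj f r.
Proof. by move=> h p q x zx bx; apply: h => //=; apply: Br_mfun. Qed.

Lemma Er_surj_compr : Er_surj (Defs.comp g f) r -> Er_surj g r.
Proof. by move=> h p q y /h[x zx bx]; exists (mfun f p q x) => //; apply: Zr_mfun. Qed.

Lemma Er_iso_comp : Er_iso f r -> Er_iso g r -> Er_iso (Defs.comp g f) r.
Proof.
move=> [fi fs] [gi gs]; split=> [p q x zx /= bx|p q y /gs[x zx bx]].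
  by apply: fi => //; apply: gi => //; apply: Zr_mfun.
have [w zw bw] := fs _ _ _ zx; exists w => //=.
rewrite -(subrK (mfun g p q x) (mfun g p q _)) -addrA -linearB /=.
(* [BrB] treats differences, so a sum u + v is read as u - (0 - v). *)
rewrite -[_ - y]opprK; apply: BrB; first exact: Br_mfun.
by rewrite -sub0r; apply: BrB => //; apply: Br_zero.
Qed.

Lemma Er_iso_compl : Er_iso (Defs.comp g f) r -> Er_iso g r -> Er_iso f r.
Proof.
move=> [gfi gfs] [gi gs]; split=> [|p q y zy]; first exact: Er_inj_compl.
have [x zx bx] := gfs _ _ _ (Zr_mfun g zy); exists x => //.
apply: gi; first by apply: ZrB => //; apply: Zr_mfun.
by rewrite linearB.
Qed.

Lemma Er_iso_compr : Er_iso (Defs.comp g f) r -> Er_iso f r -> Er_iso g r.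
Proof.
move=> [gfi gfs] [fi fs]; split=> [p q y zy by_|]; last exact: Er_surj_compr.
have [x zx bx] := fs _ _ _ zy.
have bgfx : Br r (mfun g p q (mfun f p q x)).
  rewrite -(subrK (mfun g p q y) (mfun g p q _)) -linearB /=.
  rewrite -[mfun g p q y]opprK; apply: BrB; first exact: Br_mfun.
  by rewrite -sub0r; apply: BrB => //; apply: Br_zero.
rewrite -[y](subKr (mfun f p q x)); apply: BrB => //.
by apply: Br_mfun; apply: gfi.
Qed.
End TwoOfThree.

Lemma eq_Er_iso (R : comPzRingType) (A B : mcx R) (f g : mor R A B) r :
  meq f g -> Er_iso f r -> Er_iso g r.
Proof.
move=> e [fi fs]; split=> [p q x zx|p q y /fs[x zx bx]].
  by rewrite -e; apply: fi.
by exists x; rewrite -?e.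
Qed.

Lemma sum_pair (U V : nmodType) I (r : seq I) (P : pred I) (F : I -> U) (G : I -> V) :
  \sum_(i <- r | P i) (F i, G i) = (\sum_(i <- r | P i) F i, \sum_(i <- r | P i) G i).
Proof. by elim/big_rec3: _ => // i x y z _ ->. Qed.

(** * Strict morphisms and infinity-morphisms *)

Section MorE.
Variables (R : comPzRingType) (A B : mcx R).
Variable f : forall p q, mod_of R A p q -> mod_of R B p q.
Hypothesis f_lin : forall p q, linear (@f p q).
Hypothesis f_ndd : forall i p q p' q' (x : mod_of R A p q),
  f (ndd i p' q' x) = ndd i p' q' (f x).

Definition morE : mor R A B.
Proof.
refine (@Mor R A B f f_lin _) => i p q p' q' x.
by rewrite !ddE (linear_scale _ _ (@f_lin _ _)) f_ndd.
Defined.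
End MorE.

(* An oo-morphism A ~> Y. *)
Record imor (R : comPzRingType) (A Y : mcx R) := IMor {
  ifun :> nat -> forall p q p' q', mod_of R A p q -> mod_of R Y p' q';
  ifun_lin : forall i p q p' q', linear (@ifun i p q p' q');
  ifun_deg : forall i p q p' q', (p', q') <> (p - i%:Z, q - i%:Z) ->
    forall x, @ifun i p q p' q' x = 0;
  ifun_rel : forall l p q u v x,
    \sum_(j < l.+1) ndd (l - j) u v (@ifun j p q (p - j%:Z) (q - j%:Z) x) =
    \sum_(j < l.+1) @ifun (l - j)%N _ _ u v (ndd j (p - j%:Z) (q + 1 - j%:Z) x) }.
Arguments ifun {R A Y} i0 i p q p' q'.

HB.instance Definition _ (R : comPzRingType) (A Y : mcx R) (phi : imor A Y) i p q p' q' :=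
  GRing.isLinear.Build R _ _ _ (ifun phi i p q p' q') (@ifun_lin _ _ _ phi i p q p' q').

(** * The cocylinder of an infinity-morphism *)

Section Cocylinder.
Variables (R : comPzRingType) (A Y : mcx R) (phi : imor A Y).

(* The cocylinder of phi, on which the strict maps to A and to Y replace phi. *)
Definition cyl_mod p q : lmodType R :=
  ((mod_of R A p q * mod_of R Y p q) * mod_of R Y p (q - 1))%type.

(** The third coordinate is a homotopy: (a, y, z) is an e_0-cycle exactly when a and y are and phi_0
    a - y = e_0 z. *)
Definition cyl_e i p q p' q' (w : cyl_mod p q) : cyl_mod p' q' :=
  ((ndd i p' q' w.1.1, ndd i p' q' w.1.2),
   phi i p q p' (q' - 1) w.1.1 - ndd i p' (q' - 1) w.2
   - (if i == 0%N then idm p' (q' - 1) w.1.2 else 0)).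

Lemma cyl_e_lin i p q p' q' : linear (@cyl_e i p q p' q').
Proof.
move=> c [[a y] z] [[a' y'] z']; rewrite /cyl_e /=.
congr ((_, _), _); [by rewrite linearP|by rewrite linearP|].
have -> : (if i == 0%N then idm p' (q' - 1) (c *: y + y') else 0) =
  c *: (if i == 0%N then idm p' (q' - 1) y else 0) + (if i == 0%N then idm p' (q' - 1) y' else 0).
  by case: ifP => _; rewrite ?linearP // scaler0 addr0.
rewrite [phi _ _ _ _ _ _]linearP [ndd i _ _ _]linearP /= !scalerBr !opprD.
by rewrite [X in X + _ = _]addrACA [LHS]addrACA.
Qed.

Lemma cyl_e_deg i p q p' q' : (p', q') <> (p - i%:Z, q + 1 - i%:Z) ->
  forall x, @cyl_e i p q p' q' x = 0.
Proof.
move=> ne [[a y] z]; rewrite /cyl_e /= !ndd_deg //; last first.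
  by move=> -[h1 h2]; apply: ne; congr (_, _) => //; lia.
rewrite ifun_deg; last by move=> -[h1 h2]; apply: ne; congr (_, _) => //; lia.
case: eqP => [i0|_]; last by rewrite !subr0.
rewrite idm_neq ?subr0 // => -[h1 h2]; apply: ne; congr (_, _); lia.
Qed.

Lemma cyl_e_rel l p q u v x :
  \sum_(j < l.+1) @cyl_e (l - j)%N (p - j%:Z) (q + 1 - j%:Z) u v
     (@cyl_e j p q (p - j%:Z) (q + 1 - j%:Z) x) = 0.
Proof.
case: x => [[a y] z]; rewrite /cyl_e /= sum_pair sum_pair !ndd_rel; congr (_, _).
(* Four kinds of terms occur in the third coordinate: those with phi cancel by [ifun_rel], those
   with z vanish by the relations of Y, and the two sums in y both equal e_l y, with opposite
   signs. *)
have H1 : \sum_(j < l.+1) ndd (l - j) u (v - 1) (phi j p q (p - j%:Z) (q + 1 - j%:Z - 1) a)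
  = \sum_(j < l.+1) phi (l - j)%N _ _ u (v - 1) (ndd j (p - j%:Z) (q + 1 - j%:Z) a).
  rewrite -ifun_rel; apply: eq_bigr => j _.
  by have -> : q + 1 - j%:Z - 1 = q - j%:Z by lia.
have H2 : \sum_(j < l.+1) ndd (l - j) u (v - 1) (ndd j (p - j%:Z) (q + 1 - j%:Z - 1) z) = 0.
  rewrite -[RHS](@ndd_rel R Y l _ _ u (v - 1) z); apply: eq_bigr => j _.
  by have -> : q + 1 - j%:Z - 1 = q - 1 + 1 - j%:Z by lia.
have H3 : \sum_(j < l.+1) ndd (l - j) u (v - 1)
    (if j == 0%N :> nat then idm (p - j%:Z) (q + 1 - j%:Z - 1) y else 0)
    = ndd l u (v - 1) y.
  rewrite big_ord_recl /= subn0 ndd_idm; try lia.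
  by rewrite big1 ?addr0 // => j _; rewrite linear0.
have H4 : \sum_(j < l.+1) (if (l - j)%N == 0%N then
    idm u (v - 1) (ndd j (p - j%:Z) (q + 1 - j%:Z) y) else 0) = ndd l u (v - 1) y.
  rewrite big_ord_recr /= subnn /= idm_ndd // big1 ?add0r // => j _.
  by rewrite subn_eq0 leqNgt ltn_ord.
under eq_bigr do rewrite !linearB /= !opprK.
by rewrite !big_split /= !sumrN H1 H2 H3 H4 addr0 addrA subrr add0r subrr.
Qed.

Definition cyl : mcx R := build cyl_e_lin cyl_e_deg cyl_e_rel.

Lemma ndd_cyl i p q p' q' (x : mod_of R cyl p q) : ndd i p' q' x = cyl_e i p' q' x.
Proof. exact: ndd_build. Qed.

Definition cyl_src : mor R cyl A.
Proof.
refine (@morE R cyl A (fun p q w => w.1.1) _ _); first by [].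
by move=> i p q p' q' x; rewrite ndd_cyl.
Defined.

Definition cyl_tgt : mor R cyl Y.
Proof.
refine (@morE R cyl Y (fun p q w => w.1.2) _ _); first by [].
by move=> i p q p' q' x; rewrite ndd_cyl.
Defined.

Lemma cyl_src_surj : surjective_mor cyl_src.
Proof. by move=> p q a; exists ((a, 0), 0). Qed.

Lemma cyl_tgt_surj : surjective_mor cyl_tgt.
Proof. by move=> p q y; exists ((0, y), 0). Qed.

(** The kernel is a cone on the identity of Y: a cycle (0, y, z) has y = - e_0 z and is therefore
    e_0 (0, - z, 0). *)
Lemma cyl_src_acyclic : acyclic_kernel cyl_src.
Proof.
move=> p q q' [[a y] z] hq /= -> {a} hE.
have {hE} hy : y = - ndd 0 p q' z.
  have := hE (q' + 1); rewrite ndd_cyl /cyl_e /= => -[_ _].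
  rewrite linear0 sub0r addrK idm_id => /eqP.
  by rewrite subr_eq0 => /eqP.
exists ((0, - idm p q z), 0) => //; rewrite ndd_cyl /cyl_e /= !linear0 !linearN /=.
rewrite ?(subr0, sub0r, addr0, add0r) ?opprK ndd_idm; try lia.
by rewrite hy idmK //; lia.
Qed.

(** Acyclicity of the cone of phi_0, whose elements are the pairs (a, z): this is how phi being a
    quasi-isomorphism for e_0 is expressed. *)
Definition iqis := forall p q q' t s (a : mod_of R A p q') (z : mod_of R Y p t),
  q' = q + 1 -> t = q -> s = q - 1 ->
  (forall v, phi 0%N p q' p v a = ndd 0 p v z) ->
  exists a' : mod_of R A p q, exists z' : mod_of R Y p s,
    ndd 0 p q' a' = a /\ phi 0%N p q p t a' - ndd 0 p t z' = z.

(** On the kernel y = 0, and e_0 becomes the differential of the cone of phi_0. *)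
Lemma cyl_tgt_acyclic : iqis -> acyclic_kernel cyl_tgt.
Proof.
move=> H p q q' [[a y] z] hq /= -> {y} hE.
have [||||a' [z' [h1 h2]]] := H p q q' (q' - 1) (q - 1) a z => //; first lia.
  move=> v; have := hE (v + 1); rewrite ndd_cyl /cyl_e /= => -[_ _].
  by rewrite addrK linear0 subr0 => /eqP; rewrite subr_eq0 => /eqP.
exists ((a', 0), z') => //; rewrite ndd_cyl /cyl_e /= h1 !linear0 ?(subr0, addr0) h2.
by [].
Qed.

Lemma is_n_ndd n (B : mcx R) : is_n n B <->
  forall i, ~ below n i -> forall p q p' q' (x : mod_of R B p q), ndd i p' q' x = 0.
Proof.
split=> h i ni p q p' q' x; first by rewrite /ndd h // scaler0.
by rewrite ddE h // scaler0.
Qed.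

(** The identity term of [cyl_e] sits in index 0, which therefore has to lie below n. *)
Lemma cyl_is_n n : below n 0 -> is_n n A -> is_n n Y ->
  (forall i, ~ below n i -> forall p q p' q' x, phi i p q p' q' x = 0) -> is_n n cyl.
Proof.
move=> n0; rewrite !is_n_ndd => hA hY hphi i ni p q p' q' x.
rewrite ndd_cyl /cyl_e hA // !hY // hphi // !subr0.
by case: eqP => [i0|_]; [case: ni; rewrite i0|rewrite subr0].
Qed.
End Cocylinder.

(** * Functoriality of the cocylinder *)

Section CocylinderMap.
Variables (R : comPzRingType) (A Y A' Y' : mcx R) (phi : imor A Y) (phi' : imor A' Y').
Variables (f : mor R A A') (g : mor R Y Y').
Hypothesis fg : forall i p q p' q' x,
  mfun g p' q' (phi i p q p' q' x) = phi' i p q p' q' (mfun f p q x).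

Definition cyl_map : mor R (cyl phi) (cyl phi').
Proof.
refine (@morE R (cyl phi) (cyl phi')
  (fun p q w => ((mfun f p q w.1.1, mfun g p q w.1.2), mfun g p (q - 1) w.2)) _ _).
- move=> p q c [[a y] z] [[a' y'] z'] /=; by rewrite !mfun_lin.
- move=> i p q p' q' [[a y] z]; rewrite !ndd_cyl /cyl_e /= !mfun_ndd !linearB /= fg mfun_ndd.
  by case: ifP => _; rewrite ?mfun_idm ?linear0.
Defined.
End CocylinderMap.

(** * The bicomplex Y(A) and the infinity-morphism from A to it *)

Section Rectification.
Variables (R : comPzRingType) (A : mcx R).

(* For (p', q') = (p + 1, q + 1) this is the inclusion F_(p,q) -> F_(p+1,q+1);
   for all other targets it is 0. *)
Definition shift p' q' p q (y : colseq A p q) : colseq A p' q' :=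
  fun l => if l is m.+1 then idm _ _ (y m) else 0.

(** The analogue of [idm] on the products F_(p,q), used in the component e_1 of Y(A). *)
Definition reidx p' q' p q (y : colseq A p q) : colseq A p' q' :=
  fun l => idm _ _ (y l).

Lemma shift_lin p' q' p q : linear (@shift p' q' p q).
Proof.
move=> c x y; apply: functional_extensionality_dep => -[|m] /=.
  by rewrite famDE famZE /= scaler0 [RHS]addr0.
exact: idm_lin.
Qed.
HB.instance Definition _ p' q' p q :=
  GRing.isLinear.Build R _ _ _ (@shift p' q' p q) (@shift_lin p' q' p q).

Lemma reidx_lin p' q' p q : linear (@reidx p' q' p q).
Proof. by move=> c x y; apply: functional_extensionality_dep => j; apply: idm_lin. Qed.
HB.instance Definition _ p' q' p q :=
  GRing.isLinear.Build R _ _ _ (@reidx p' q' p q) (@reidx_lin p' q' p q).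

Lemma shift_deg p' q' p q (y : colseq A p q) : (p', q') <> (p + 1, q + 1) -> shift p' q' y = 0.
Proof.
move=> ne; apply: functional_extensionality_dep => -[//|m]; apply: idm_neq => -[h1 h2].
by apply: ne; congr (_, _); lia.
Qed.

Lemma reidx_deg p' q' p q (y : colseq A p q) : (p', q') <> (p, q) -> reidx p' q' y = 0.
Proof.
move=> ne; apply: functional_extensionality_dep => m; apply: idm_neq => -[h1 h2].
by apply: ne; congr (_, _); lia.
Qed.

Lemma totat_shift l u v p1 q1 p q (y : colseq A p q) : p1 = p + 1 -> q1 = q + 1 ->
  totat l.+1 u v (shift p1 q1 y) = totat l u v y.
Proof.
move=> hp hq; rewrite /totat big_ord_recl linear0 add0r; apply: eq_bigr => j _ /=.
by rewrite ndd_idm // /bump /=; lia.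
Qed.

Lemma totat_reidx l u v p1 q1 p q (y : colseq A p q) : p1 = p -> q1 = q ->
  totat l u v (reidx p1 q1 y) = totat l u v y.
Proof. by move=> hp hq; apply: eq_bigr => j _ /=; rewrite ndd_idm // ?hp ?hq. Qed.

Lemma idm_totat_any l u v u' v' p q (x : colseq A p q) :
  u = p - l%:Z -> v = q + 1 - l%:Z -> idm u' v' (totat l u v x) = totat l u' v' x.
Proof.
move=> hu hv; have [[-> ->]|ne] := pselect ((u', v') = (u, v)); first by rewrite idm_id.
by rewrite idm_neq // totat_deg // -hu -hv.
Qed.

Lemma tot_shift p2 q2 p1 q1 p3 q3 p q (y : colseq A p q) :
  p1 = p + 1 -> q1 = q + 1 -> p3 = p -> q3 = q + 1 ->
  tot p2 q2 (shift p1 q1 y) = shift p2 q2 (tot p3 q3 y).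
Proof.
move=> h1 h2 h3 h4; apply: functional_extensionality_dep => -[|m]; rewrite /tot /=.
  by rewrite /totat big_ord1 linear0.
by rewrite totat_shift // idm_totat_any //; rewrite ?h3 ?h4.
Qed.

Lemma tot_reidx p2 q2 p1 q1 p3 q3 p q (y : colseq A p q) :
  p1 = p -> q1 = q -> p3 = p -> q3 = q + 1 ->
  tot p2 q2 (reidx p1 q1 y) = reidx p2 q2 (tot p3 q3 y).
Proof.
move=> h1 h2 h3 h4; apply: functional_extensionality_dep => m; rewrite /tot /reidx.
by rewrite (totat_reidx _ _ _ _ h1 h2) idm_totat_any // ?h3 ?h4.
Qed.

Definition rect_mod p q : lmodType R := (colseq A p q * colseq A (p - 1) q)%type.

Definition rect_e i p q p' q' (w : rect_mod p q) : rect_mod p' q' :=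
  match i with
  | 0 => (tot p' q' w.1 + shift p' q' w.2, - tot (p' - 1) q' w.2)
  | 1 => (- reidx p' q' w.2, 0)
  | _ => 0
  end.

Lemma rect_e_lin i p q p' q' : linear (@rect_e i p q p' q').
Proof.
move=> c [x y] [x' y']; case: i => [|[|i]] /=; last by rewrite scaler0 addr0.
- congr (_, _) => /=; last by rewrite linearP /= opprD scalerN.
  by rewrite !linearP /= scalerDr addrACA.
- by congr (_, _) => /=; rewrite ?linearP /= ?opprD ?scalerN // scaler0 addr0.
Qed.

Lemma rect_e_deg i p q p' q' : (p', q') <> (p - i%:Z, q + 1 - i%:Z) ->
  forall x, @rect_e i p q p' q' x = 0.
Proof.
move=> ne [x y]; case: i ne => [|[|i]] //= ne.
- rewrite tot_deg ?shift_deg ?tot_deg ?addr0 ?oppr0 //;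
    by move=> -[h1 h2]; apply: ne; congr (_, _); lia.
- by rewrite reidx_deg ?oppr0 // => -[h1 h2]; apply: ne; congr (_, _); lia.
Qed.

(** Index 0 holds because D squares to zero and commutes with the inclusion of F_(p-1); in index 1
    the terms - D y and D y cancel; from index 2 on only e_1 e_1 could contribute, and e_1 kills
    first coordinates. *)
Lemma rect_e_rel l p q u v x :
  \sum_(j < l.+1) @rect_e (l - j)%N (p - j%:Z) (q + 1 - j%:Z) u v
     (@rect_e j p q (p - j%:Z) (q + 1 - j%:Z) x) = 0.
Proof.
case: x => x y; case: l => [|[|l]].
- rewrite big_ord1 /= linearN linearD /= tot_tot add0r linearN /= opprK tot_tot.
  by rewrite (@tot_shift _ _ _ _ (p - 0%:Z - 1) (q + 1 - 0%:Z)) ?subrr //; lia.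
- rewrite big_ord_recr big_ord1 /= !linear0 /= linearN opprK addr0 linearN /=.
  rewrite (@tot_reidx _ _ _ _ (p - 0%:Z - 1) (q + 1 - 0%:Z)); try lia.
  by congr (_, _); rewrite /= !addr0 ?subrr.
- apply: big1 => -[[|[|j]] /= jl] _.
  + by [].
  + by case: l jl => [|l] //= _; rewrite linear0 oppr0.
  + by apply: linear_f0; apply: rect_e_lin.
Qed.

Definition rect : mcx R := build rect_e_lin rect_e_deg rect_e_rel.

Lemma ndd_rect i p q p' q' (x : mod_of R rect p q) : ndd i p' q' x = rect_e i p' q' x.
Proof. exact: ndd_build. Qed.

Lemma rect_is_n n : ninf_le (Fin 2) n -> is_n n rect.
Proof.
move=> n2; rewrite is_n_ndd => i ni p q p' q' x; rewrite ndd_rect.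
by case: i ni => [|[|i]] // ni; case: ni; case: n n2 => //= m; lia.
Qed.

(** For i = 0 the second coordinate cancels the tail (e_1 a, e_2 a, ...) of D (a, 0, 0, ...), so
    that the first coordinate of e_0 (phi_0 a) is e_0 a alone. The higher phi_i consist of later
    tails of the same sequence. *)
Definition rect_phi i p q p' q' (a : mod_of R A p q) : mod_of R rect p' q' :=
  ((fun j => if (i == 0%N) && (j == 0%N) then idm _ _ a else 0) : colseq A p' q',
   (fun j => - ndd (i.+1 + j) _ _ a) : colseq A (p' - 1) q').

Lemma rect_phi_lin i p q p' q' : linear (@rect_phi i p q p' q').
Proof.
move=> c x y; congr (_, _); apply: functional_extensionality_dep => j /=.
  rewrite famDE famZE; case: ifP => _; first exact: linearP.
  by rewrite scaler0 addr0.
by rewrite famDE famZE linearP opprD scalerN.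
Qed.

Lemma rect_phi_deg i p q p' q' : (p', q') <> (p - i%:Z, q - i%:Z) ->
  forall x, @rect_phi i p q p' q' x = 0.
Proof.
move=> ne x; congr (_, _); apply: functional_extensionality_dep => j /=.
  case: ifP => // /andP[/eqP i0 /eqP j0]; apply: idm_neq => -[h1 h2]; apply: ne.
  by congr (_, _); lia.
rewrite ndd_deg ?oppr0 // => -[h1 h2]; apply: ne; congr (_, _); lia.
Qed.

Lemma rect_e_sum l (F : forall j : nat, int * int) u v
    (w : forall j, rect_mod (F j).1 (F j).2) :
  \sum_(j < l.+1) rect_e (l - j)%N u v (w j) =
  rect_e 0 u v (w l) + (if l is k.+1 then rect_e 1 u v (w k) else 0).
Proof.
rewrite big_ord_recr /= subnn addrC; congr (_ + _).
case: l => [|k]; first by rewrite big_ord0.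
rewrite big_ord_recr /= subSnn big1 ?add0r // => j _.
by have := ltn_ord j; case D : (k.+1 - j)%N => [|[|i]] //; lia.
Qed.

Lemma rect_phi_rel l p q u v a :
  \sum_(j < l.+1) ndd (l - j) u v (@rect_phi j p q (p - j%:Z) (q - j%:Z) a) =
  \sum_(j < l.+1) rect_phi (l - j)%N u v (ndd j (p - j%:Z) (q + 1 - j%:Z) a).
Proof.
under eq_bigr do rewrite ndd_rect.
rewrite (@rect_e_sum l (fun j => (p - j%:Z, q - j%:Z))
  u v (fun j => @rect_phi j p q (p - j%:Z) (q - j%:Z) a)).
rewrite /rect_phi sum_pair.
transitivity (((fun m => if m == 0%N then ndd l _ _ a else 0) : colseq A u v,
  (fun m => - \sum_(j < l.+1) ndd ((l - j).+1 + m) _ _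
      (ndd j (p - j%:Z) (q + 1 - j%:Z) a)) : colseq A (u - 1) v)); last first.
  congr (_, _); apply: functional_extensionality_dep => m; rewrite fam_sumE; last first.
    by rewrite -sumrN.
  rewrite big_ord_recr /= subnn /= big1 ?add0r.
    by case: eqP => // _; rewrite idm_ndd.
  by move=> j _; rewrite subn_eq0 leqNgt ltn_ord.
(* The relation of index l + 1 + m in A, split after j = l: the terms with j > l are D of a tail of
   (e_i a). *)
have Hphi2 m : totat m (u - 1 - m%:Z) (v - m%:Z)
     ((fun j => - ndd (l.+1 + j) _ _ a) : colseq A (p - l%:Z - 1) (q - l%:Z)) =
   \sum_(j < l.+1) ndd ((l - j).+1 + m) (u - 1 - m%:Z) (v - m%:Z)
      (ndd j (p - j%:Z) (q + 1 - j%:Z) a).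
  have := @ndd_rel R A (l.+1 + m) p q (u - 1 - m%:Z) (v - m%:Z) a.
  rewrite -addnS big_split_ord /= => /eqP; rewrite addr_eq0 => /eqP.
  under eq_bigr => j _.
    have -> : (l.+1 + m - j = (l - j).+1 + m)%N by have := ltn_ord j; lia.
    over.
  move=> ->; rewrite /totat -sumrN; apply: eq_bigr => j _.
  rewrite linearN /= subnDl; congr (- _).
  have -> : p - l%:Z - 1 - j%:Z = p - (l.+1 + j)%:Z by lia.
  by have -> : q - l%:Z - j%:Z = q + 1 - (l.+1 + j)%:Z by lia.
congr (_, _) => /=; last first.
  rewrite [X in _ + X = _](_ : _ = 0) ?[LHS]addr0; last by case: l {Hphi2}.
  by apply: functional_extensionality_dep => m; rewrite famNE /tot Hphi2.
apply: functional_extensionality_dep => m; rewrite !famDE.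
case: l Hphi2 => [|k] _ /=.
  rewrite fam0E [LHS]addr0 /tot; case: m => [|m] /=.
    by rewrite [LHS]addr0 /totat big_ord1 /= ndd_idm //; lia.
  rewrite linearN /= idm_ndd; try lia.
  rewrite /totat big_ord_recl /= ndd_idm; try lia.
  by rewrite big1 ?addr0 ?subrr // => j _; rewrite linear0.
(* For l = k + 1 the first coordinate is (e_(k+1) a, e_(k+2) a, ...), from e_1 phi_k, minus (0,
   e_(k+2) a, ...), from e_0 phi_(k+1); only e_(k+1) a in entry 0 remains. *)
rewrite /tot (_ : totat _ _ _ _ = 0) ?add0r; last first.
  by rewrite /totat big1 // => j _; rewrite linear0.
rewrite famNE /reidx [idm _ _ (- _)]linearN /= idm_ndd ?opprK; try lia.
case: m => [|m] /=; first by rewrite add0r addn0.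
by rewrite linearN /= idm_ndd ?addnS ?addSn ?addNr //; lia.
Qed.

Definition rect_imor : imor A rect := IMor rect_phi_lin rect_phi_deg rect_phi_rel.

Lemma rect_imor_iqis : iqis rect_imor.
Proof.
move=> p q q' t s a [x y] hq' ht hs H; subst q' t s.
have := H (q + 1); rewrite ndd_rect /= => -[H1 _].
have {}H1 j : (if j == 0%N then idm _ _ a else 0) =
    totat j (p - j%:Z) (q + 1 - j%:Z) x + (shift p (q + 1) y) j.
  exact: (congr1 (fun g : colseq A p (q + 1) => g j) H1).
(* Entry 0 of phi_0 a = e_0 (x, y) reads a = e_0 x_0, which suggests a' = x_0. The choice z' = (0, -
   (x_1, x_2, ...)) restores the other entries of x, and the entries j + 1 of the hypothesis then
   identify y. *)
exists (idm p q (x 0%N)).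
exists ((0 : colseq A p (q - 1),
  (fun m => - idm _ _ (x m.+1)) : colseq A (p - 1) (q - 1))); split.
  rewrite ndd_idm ?subr0 //.
  have /= := H1 0%N; rewrite [X in _ = X -> _]addr0 /totat big_ord1 subnn.
  move=> /(congr1 (@idm R (mod_of R A) _ _ p (q + 1))).
  by rewrite idmK ?subr0 // idm_ndd ?subr0 //; lia.
rewrite ndd_rect /= linear0 add0r; congr (_, _); rewrite /= ?opprK.
  apply: functional_extensionality_dep => -[|m]; rewrite famDE famNE /=.
    by rewrite [LHS]subr0 idmK //; lia.
  by rewrite linearN /= opprK add0r idmK //; lia.
apply: functional_extensionality_dep => j; rewrite famDE /=.
have /= := H1 j.+1.
have -> : p - j.+1%:Z = p - 1 - j%:Z by lia.
have -> : q + 1 - j.+1%:Z = q - j%:Z by lia.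
rewrite idm_id => /esym/eqP; rewrite addr_eq0 => /eqP HT; rewrite -[RHS]opprK -HT.
rewrite /totat big_ord_recl /= opprD ndd_idm ?subr0 //.
congr (_ + _); rewrite /tot /totat -sumrN; apply: eq_bigr => i _.
by rewrite linearN /= ndd_idm // /bump /=; lia.
Qed.

Lemma rect_imor_is_n n : ninf_le (Fin 2) n -> is_n n A ->
  forall i, ~ below n i -> forall p q p' q' x, rect_imor i p q p' q' x = 0.
Proof.
move=> n2; rewrite is_n_ndd => hA i ni p q p' q' x; congr (_, _).
  apply: functional_extensionality_dep => j /=.
  by case: eqP => // i0; case: ni; rewrite i0; case: n n2 {hA} => //= m; lia.
apply: functional_extensionality_dep => j /=; rewrite hA ?oppr0 //.
by move=> h; apply: ni; case: n n2 {hA} h => //= m; lia.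
Qed.

End Rectification.

(** * Functoriality of Y(A) *)

Section RectificationMap.
Variables (R : comPzRingType) (A B : mcx R) (f : mor R A B).

Definition colseq_map p q (x : colseq A p q) : colseq B p q := fun j => mfun f _ _ (x j).

Definition rect_map : mor R (rect A) (rect B).
Proof.
refine (@morE R (rect A) (rect B)
  (fun p q w => (colseq_map w.1, colseq_map w.2)) _ _).
- move=> p q c [x y] [x' y'] /=.
  by congr (_, _); apply: functional_extensionality_dep => j; apply: mfun_lin.
- move=> i p q p' q' [x y]; rewrite !ndd_rect.
  case: i => [|[|i]] /=; congr (_, _); apply: functional_extensionality_dep => j;
    rewrite /colseq_map ?(famDE, famNE, fam0E) ?(linear0, linearD, linearN) //=.
  + rewrite /tot mfun_totat; congr (_ + _).
    by case: j => [|j] /=; rewrite ?linear0 ?mfun_idm.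
  + by rewrite /tot mfun_totat.
  + by rewrite /reidx mfun_idm.
Defined.

Lemma rect_map_imor i p q p' q' x :
  mfun rect_map p' q' (rect_imor A i p q p' q' x) =
  rect_imor B i p q p' q' (mfun f p q x).
Proof.
congr (_, _); apply: functional_extensionality_dep => j /=; rewrite /colseq_map /=.
  by case: ifP => _; rewrite ?linear0 ?mfun_idm.
by rewrite linearN /= mfun_ndd.
Qed.
End RectificationMap.

(** * The unit of the adjunction and the Quillen equivalence *)

Definition idmor (R : comPzRingType) (A : mcx R) : mor R A A :=
  @Mor R A A (fun _ _ x => x) (fun _ _ _ _ _ => erefl) (fun _ _ _ _ _ _ => erefl).

Lemma Er_iso_id (R : comPzRingType) (A : mcx R) r : Er_iso (idmor A) r.
Proof. by split=> // p q y zy; exists y => //; rewrite subrr; apply: Br_zero. Qed.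

Lemma ninf_le_trans a b c : ninf_le a b -> ninf_le b c -> ninf_le a c.
Proof. by case: a b c => [a|] [b|] [c|] //=; apply: leq_trans. Qed.

Lemma is_n_le (R : comPzRingType) (n l : ninf) (A : mcx R) :
  ninf_le n l -> is_n n A -> is_n l A.
Proof.
move=> nl hA i li; apply: hA => ni; apply: li.
by case: n l nl ni => [n|] [l|] //= nl ni; apply: leq_trans nl.
Qed.

Lemma cyl_rect_is_n (R : comPzRingType) n (A : mcx R) :
  ninf_le (Fin 2) n -> is_n n A -> is_n n (cyl (rect_imor A)).
Proof.
move=> n2 hA; apply: cyl_is_n => //; [|exact: rect_is_n|exact: rect_imor_is_n].
by case: n n2 {hA} => //= m; apply: ltn_trans.
Qed.

Lemma unit_weq (R : comPzRingType) (n l : ninf) (r : nat) (A P : mcx R) (pi : mor R A P) :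
  ninf_le (Fin 2) n -> ninf_le n l -> cofibrant l r A -> left_adj_unit n pi -> weq r pi.
Proof.
move=> n2 nl [Al Acof] [Pn Puniv].
pose XA := cyl (rect_imor A); pose XP := cyl (rect_imor P).
pose xA : mor R XA A := cyl_src _; pose xP : mor R XP P := cyl_src _.
pose yA : mor R XA (rect A) := cyl_tgt _; pose yP : mor R XP (rect P) := cyl_tgt _.
pose Xpi : mor R XA XP := cyl_map (rect_map_imor pi).
have xweq (B : mcx R) : tfib r (cyl_src (rect_imor B)).
  by apply: acyclic_surj_tfib; [apply: cyl_src_surj|apply: cyl_src_acyclic].
have yweq (B : mcx R) : weq r (cyl_tgt (rect_imor B)).
  apply: acyclic_surj_weq; first exact: cyl_tgt_surj.
  by apply: cyl_tgt_acyclic; apply: rect_imor_iqis.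
have l2 := ninf_le_trans n2 nl.
(* The section s is a lift of the identity of A along X(A) -> A, in a square starting at the zero
   multicomplex. *)
have [|s [_ xs]] := Acof XA A (cyl_rect_is_n l2 Al) Al xA (xweq A) (from_zero XA) (idmor A).
  by move=> p q z.
have [f [fpi _]] := Puniv (rect A) (@rect_is_n _ A _ n2) (Defs.comp yA s).
have [t [tpi _]] := Puniv XP (cyl_rect_is_n n2 Pn) (Defs.comp Xpi s).
(* Maps from P to an object of Ch_n may be compared after composing with [pi]; here xP t pi = xP Xpi
   s = pi xA s = pi. *)
have xt : meq (Defs.comp xP t) (idmor P).
  have [i [_ iu]] := Puniv P Pn pi.
  move=> p q x; rewrite (iu (Defs.comp xP t)); first by rewrite (iu (idmor P)).
  move=> p' q' a /=; rewrite [mfun t _ _ _]tpi /=.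
  by rewrite [X in mfun pi _ _ X]xs.
have ft : meq (Defs.comp (rect_map pi) f) (Defs.comp yP t).
  have [i [_ iu]] := Puniv (rect P) (@rect_is_n _ P _ n2) (Defs.comp yP (Defs.comp Xpi s)).
  move=> p q x; rewrite (iu (Defs.comp (rect_map pi) f)).
    rewrite (iu (Defs.comp yP t)) // => p' q' a /=.
    by rewrite [mfun t _ _ _]tpi.
  by move=> p' q' a /=; rewrite [mfun f _ _ _]fpi.
have s_iso : Er_iso s r.+1.
  apply: Er_iso_compl (proj1 (xweq A)).
  by apply: eq_Er_iso (Er_iso_id A r.+1) => p q x; rewrite xs.
have t_iso : Er_iso t r.+1.
  apply: Er_iso_compl (proj1 (xweq P)).
  by apply: eq_Er_iso (Er_iso_id P r.+1) => p q x; rewrite xt.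
have fpi_iso : Er_iso (Defs.comp f pi) r.+1.
  apply: (@eq_Er_iso _ _ _ (Defs.comp yA s)); first by move=> p q x; rewrite fpi.
  by apply: Er_iso_comp => //; apply: yweq.
(* A two-out-of-six argument: surjectivity comes from f pi, injectivity from Y(pi) f. *)
have f_iso : Er_iso f r.+1.
  split; last by case: fpi_iso => _; apply: Er_surj_compr.
  apply: (@Er_inj_compl _ _ _ _ f (rect_map pi)).
  have [] : Er_iso (Defs.comp (rect_map pi) f) r.+1 => //.
  apply: (@eq_Er_iso _ _ _ (Defs.comp yP t)); first by move=> p q x; rewrite ft.
  by apply: Er_iso_comp => //; apply: yweq.
exact: Er_iso_compl fpi_iso f_iso.
Qed.

Theorem mainTheorem13 (R : comPzRingType) (n l : ninf) (r : nat) :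
  ninf_le (Fin 2) n -> ninf_le n l -> @quillen_equiv_incl R n l r.
Proof.
move=> n2 nl; split=> [X Y f Xn Yn|A Al Ac P pi Pu X _ f].
  (* Fibrations and weak equivalences are defined independently of n, so only membership in Ch_l has
     to be checked. *)
  have Xl := is_n_le nl Xn; have Yl := is_n_le nl Yn.
  by split=> hf; split=> //; split.
have pi_weq := unit_weq n2 nl Ac Pu.
split=> h; first exact: Er_iso_comp.
exact: Er_iso_compr h pi_weq.
Qed.
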